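(* Let $n\ge 1$ and $w\in S_n$. Then $$\mathfrak G^{(\beta)}_w(\mathbf x;\mathbf y)=\sum_{(\mathcal P,\mathcal S)\in \mathsf{MPipes}(w)}\beta^{|D(\mathcal P)|+|\mathcal S|-\ell(w)}\Big(\prod_{(i,j)\in D(\mathcal P)\cup\mathcal S}(x_i\oplus y_j)\Big).$$
   Context: Permutations $w\in S_n$ are written in one-line notation $w=w_1\cdots w_n$; $s_i=(i\ i+1)$; $\ell(w)$ is the Coxeter length; $w_0=n\,(n-1)\cdots 1$; $x_i\oplus y_j=x_i+y_j+\beta x_iy_j$. Bumpless pipe dreams. Cells of the $n\times n$ grid are indexed $(i,j)$: row $i$ from the top, column $j$ from the left. There are six tiles: downward elbow (a pipe joining the bottom and right edges), upward elbow (a pipe joining the left and top edges), crossing (one pipe joining left and right edges and one joining bottom and top edges), blank (no pipe), horizontal (a pipe joining left and right edges), vertical (a pipe joining bottom and top edges). A bumpless pipe dream (BPD) of size $n$ is a tiling of the $n\times n$ grid by these tiles such that an edge shared by two cells is met by a pipe from both sides or from neither, every edge on the bottom boundary and every edge on the right boundary of the grid is met by a pipe, and no edge on the left or top boundary is met by a pipe. $D(\mathcal P)$ is the set of positions of blank tiles of $\mathcal P$ and $U(\mathcal P)$ is the set of positions of upward elbow tiles. Demazure product $\partial(\mathcal P)\in S_n$ of a BPD $\mathcal P$: label the bottom boundary edges $1,\dots,n$ from left to right and propagate labels along pipes north and east; at a crossing tile, of the two labels entering from the left and from below, the smaller one leaves through the right edge and the larger one through the top edge. Then $\partial(\mathcal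 P)(i)$ is the label arriving at the right boundary edge of row $i$. $\mathsf{Pipes}(w)$ is the set of BPDs $\mathcal P$ of size $n$ with $\partial(\mathcal P)=w$. $\mathsf{MPipes}(w)$ is the set of marked BPDs for $w$: pairs $(\mathcal P,\mathcal S)$ with $\mathcal P\in\mathsf{Pipes}(w)$ and $\mathcal S\subseteq U(\mathcal P)$. $\beta$-double Grothendieck polynomials: $S_n$ acts on $\mathbb Z[\beta][y_1,\dots,y_n][x_1,\dots,x_n]$ by $w\cdot f=f(x_{w_1},\dots,x_{w_n};\mathbf y)$. Let $\pi_i(f)=\dfrac{(1+\beta x_{i+1})f-(1+\beta x_i)\,s_i\cdot f}{x_i-x_{i+1}}$. Set $\mathfrak G^{(\beta)}_{w_0}(\mathbf x;\mathbf y)=\prod_{i,j\ge1,\ i+j\le n}(x_i\oplus y_j)$, and whenever $w_i>w_{i+1}$ set $\mathfrak G^{(\beta)}_{ws_i}(\mathbf x;\mathbf y)=\pi_i(\mathfrak G^{(\beta)}_w(\mathbf x;\mathbf y))$; this is well defined. *)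

(* Defs.v *)
From HB Require Import structures.
From mathcomp Require Import all_boot all_order all_algebra all_fingroup.
From mathcomp Require Import mpoly.

Set Implicit Arguments.
Unset Strict Implicit.
Unset Printing Implicit Defensive.

Import GRing.Theory.
Local Open Scope ring_scope.

(* Rows, columns, variables and one-line positions are indexed from 0 by 'I_n,
   rows from the top and columns from the left; pipe labels are the numbers
   1, ..., n. *)

Inductive tile := DownElbow | UpElbow | Crossing | Blank | Horizontal | Vertical.

Definition left_edge (t : tile) : bool :=
  match t with UpElbow | Crossing | Horizontal => true | _ => false end.
Definition right_edge (t : tile) : bool :=
  match t with DownElbow | Crossing | Horizontal => true | _ => false end.
Definition top_edge (t : tile) : bool :=
  match t with UpElbow | Crossing | Vertical => true | _ => false end.
Definition bottom_edge (t : tile) : bool :=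
  match t with DownElbow | Crossing | Vertical => true | _ => false end.

Definition nat_of_tile (t : tile) : nat :=
  match t with
  | DownElbow => 0 | UpElbow => 1 | Crossing => 2
  | Blank => 3 | Horizontal => 4 | Vertical => 5
  end.
Definition tile_of_nat (k : nat) : tile :=
  nth Vertical [:: DownElbow; UpElbow; Crossing; Blank; Horizontal] k.
Lemma nat_of_tileK : cancel nat_of_tile tile_of_nat.
Proof. by case. Qed.
HB.instance Definition _ := Countable.copy tile (can_type nat_of_tileK).
Lemma tile_enumP :
  Finite.axiom [:: DownElbow; UpElbow; Crossing; Blank; Horizontal; Vertical].
Proof. by case. Qed.
HB.instance Definition _ := isFinite.Build tile tile_enumP.

Definition is_bpd n (P : 'M[tile]_n) : bool :=
  [&& [forall i : 'I_n, forall j : 'I_n, forall j' : 'I_n,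
         (j' == j.+1 :> nat) ==> (right_edge (P i j) == left_edge (P i j'))],
      [forall i : 'I_n, forall i' : 'I_n, forall j : 'I_n,
         (i' == i.+1 :> nat) ==> (bottom_edge (P i j) == top_edge (P i' j))],
      [forall i : 'I_n, forall j : 'I_n, (i.+1 == n) ==> bottom_edge (P i j)],
      [forall i : 'I_n, forall j : 'I_n, (j.+1 == n) ==> right_edge (P i j)],
      [forall i : 'I_n, forall j : 'I_n, (j == 0%N :> nat) ==> ~~ left_edge (P i j)] &
      [forall i : 'I_n, forall j : 'I_n, (i == 0%N :> nat) ==> ~~ top_edge (P i j)]].

Definition blanks n (P : 'M[tile]_n) : {set 'I_n * 'I_n} :=
  [set c | P c.1 c.2 == Blank].

Definition upelbows n (P : 'M[tile]_n) : {set 'I_n * 'I_n} :=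
  [set c | P c.1 c.2 == UpElbow].

(* From the labels l, b entering a tile through its left and bottom edges, the
   pair of the labels leaving through its right and top edges; the dummy label
   0 marks an edge met by no pipe. *)
Definition tile_out (t : tile) (l b : nat) : nat * nat :=
  match t with
  | DownElbow => (b, 0%N)
  | UpElbow => (0%N, l)
  | Crossing => (minn l b, maxn l b)
  | Blank => (0%N, 0%N)
  | Horizontal => (l, 0%N)
  | Vertical => (0%N, b)
  end.

(* Label entering column j from the left, for a row with tiles t and labels v
   entering it from below. *)
Fixpoint row_label (t : nat -> tile) (v : nat -> nat) (j : nat) : nat :=
  if j is j'.+1 then (tile_out (t j') (row_label t v j') (v j')).1 else 0%N.

Definition tile_at n (P : 'M[tile]_n) (i j : nat) : tile :=
  match insub i : option 'I_n, insub j : option 'I_n with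
  | Some i', Some j' => P i' j'
  | _, _ => Blank
  end.

(* Label crossing, in column j, the horizontal line k rows above the bottom. *)
Fixpoint col_label n (P : 'M[tile]_n) (k j : nat) : nat :=
  if k is k'.+1 then
    let t := tile_at P (n - k) in let v := col_label P k' in
    (tile_out (t j) (row_label t v j) (v j)).2
  else j.+1.

(* Label arriving at the right boundary edge of row i. *)
Definition exit_label n (P : 'M[tile]_n) (i : 'I_n) : nat :=
  row_label (tile_at P i) (col_label P (n - i.+1)) n.

(* The Demazure product of P is w; labels are 1-based whereas w is 0-based. *)
Definition has_demazure n (P : 'M[tile]_n) (w : 'S_n) : bool :=
  [forall i : 'I_n, exit_label P i == (w i).+1].

Definition Pipes n (w : 'S_n) : {set 'M[tile]_n} :=
  [set P | is_bpd P && has_demazure P w].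

Definition MPipes n (w : 'S_n) : {set 'M[tile]_n * {set 'I_n * 'I_n}} :=
  [set PS : 'M[tile]_n * {set 'I_n * 'I_n} |
     (PS.1 \in Pipes w) && (PS.2 \subset upelbows PS.1)].

Definition simple_refl n : {set 'S_n} :=
  [set tperm p.1 p.2 | p : 'I_n * 'I_n & p.2 == p.1.+1 :> nat].

Lemma tperm_simple_gen n (i j : 'I_n) :
  (i < j)%N -> tperm i j \in <<simple_refl n>>%g.
Proof.
case: j => j; elim: j => [|j IHj] ltjn //= ltij.
have ltj : (j < n)%N := ltnW ltjn.
have s_in : tperm (Ordinal ltj) (Ordinal ltjn) \in <<simple_refl n>>%g.
  by apply/mem_gen/imsetP; exists (Ordinal ltj, Ordinal ltjn); rewrite ?inE.
have [eq_ij|ne_ij] := eqVneq (i : nat) j.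
  by have -> : i = Ordinal ltj by apply: val_inj.
have ltij' : (i < j)%N by rewrite ltn_neqAle ne_ij -ltnS.
have -> : tperm i (Ordinal ltjn)
    = (tperm i (Ordinal ltj) ^ tperm (Ordinal ltj) (Ordinal ltjn))%g.
  rewrite tpermJ tpermL tpermD //; apply/eqP => /(congr1 val) /= /eqP.
    by rewrite eq_sym (negPf ne_ij).
  by rewrite eq_sym (ltn_eqF ltij).
by rewrite groupJ // IHj.
Qed.

Lemma simple_refl_word n (w : 'S_n) : exists k, w \in (simple_refl n ^+ k)%g.
Proof.
have : w \in <<simple_refl n>>%g.
  have [ts -> _] := prod_tpermP w; rewrite group_prod // => -[i j] _ /=.
  have [ltij|ltji|/val_inj ->] := ltngtP i j.
  - exact: tperm_simple_gen.
  - by rewrite tpermC tperm_simple_gen.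
  - by rewrite tperm1 group1.
case/gen_prodgP => k [c c_in ->]; exists k.
rewrite -[k in (_ ^+ k)%g]card_ord -prodg_const.
by apply: mem_prodg => i _.
Qed.

(* In the group of subsets, A ^+ k is the set of products of k elements of A. *)
Definition coxeter_length n (w : 'S_n) : nat := ex_minn (simple_refl_word w).

Section Grothendieck.

Variable n : nat.

(* Z[beta][y_1, ..., y_n][x_1, ..., x_n] *)
Definition gring := {mpoly {mpoly {poly int}[n]}[n]}.

Definition beta : gring := (('X : {poly int})%:MP)%:MP.
Definition xvar (i : 'I_n) : gring := 'X_i.
Definition yvar (j : 'I_n) : gring := ('X_j)%:MP.

Definition oplus (i j : 'I_n) : gring :=
  xvar i + yvar j + beta * xvar i * yvar j.

Definition longest : 'S_n := perm (@rev_ord_inj n).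

(* g = pi_i(f), where j = i + 1; since gring is a domain, at most one g
   satisfies the equation. *)
Definition is_pi (i j : 'I_n) (f g : gring) : Prop :=
  (xvar i - xvar j) * g
  = (1 + beta * xvar j) * f - (1 + beta * xvar i) * msym (tperm i j) f.

(* is_grothendieck w g: the recursion gives g as a value of the Grothendieck
   polynomial of w. Permutations are multiplied left to right, so that
   tperm i j * w maps k to w (s_i k): it is w s_i in one-line notation. *)
Inductive is_grothendieck : 'S_n -> gring -> Prop :=
| Groth_longest :
    is_grothendieck longest
      (\prod_(i < n) \prod_(j < n | (i.+1 + j.+1 <= n)%N) oplus i j)
| Groth_descent (w : 'S_n) (i j : 'I_n) (f g : gring) :
    j = i.+1 :> nat -> (w j < w i)%N ->
    is_grothendieck w f -> is_pi i j f g ->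
    is_grothendieck (tperm i j * w)%g g.

End Grothendieck.

(* Main.v *)
Require Import Defs.
From HB Require Import structures.
From mathcomp Require Import all_boot all_order all_algebra all_fingroup.
From mathcomp Require Import mpoly zify ring.

(** Put X_i = 1 + beta x_i and Y_j = 1 + beta y_j, so that
    1 + beta (x_i (+) y_j) = X_i Y_j. Expanding the markings, the right-hand side
    times beta^l(w) is the partition function Z(w) of a coloured lattice model in
    which a blank tile weighs X_i Y_j - 1, an upward elbow X_i Y_j, and any other
    tile 1. An R-matrix satisfying the Yang-Baxter equation can be dragged from
    left to right through rows i and i+1; reading off the exit labels gives,
    whenever w_i > w_{i+1},
      (X_i - X_{i+1}) Z(w s_i) = X_{i+1} Z(w) - X_i s_i(Z(w)),
    which is pi_i up to a factor beta. Only one configuration contributes to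
    Z(w_0). That every exponent |D| + |S| - l(w) is nonnegative follows from the
    same recursion: beta^l(w) divides (x_i - x_{i+1}) Z(w), and at x_k = k, y = 0
    all terms of Z(w) become positive multiples of powers of beta, so no
    cancellation can occur. *)

Set Implicit Arguments.
Unset Strict Implicit.
Unset Printing Implicit Defensive.

Import GRing.Theory.
Local Open Scope ring_scope.

(** * The lattice model *)

(** Only the incoming edges are tested; the right and top edges are tested as inputs of the
    neighbouring tiles or at the boundary. Label 0 means no pipe. *)
Definition fits (t : tile) (l b : nat) : bool :=
  (left_edge t == (l != 0%N)) && (bottom_edge t == (b != 0%N)).

Lemma big_tile (R : nmodType) (P : pred tile) (F : tile -> R) :
  \sum_(t : tile | P t) F t =
  (if P DownElbow then F DownElbow else 0) + (if P UpElbow then F UpElbow else 0)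
  + (if P Crossing then F Crossing else 0) + (if P Blank then F Blank else 0)
  + (if P Horizontal then F Horizontal else 0) + (if P Vertical then F Vertical else 0).
Proof.
have -> : index_enum tile =
    [:: DownElbow; UpElbow; Crossing; Blank; Horizontal; Vertical].
  by rewrite /index_enum !unlock.
by rewrite big_mkcond /= !big_cons big_nil addr0 !addrA.
Qed.

Section Lattice.

Variable R : comNzRingType.
Implicit Types (x y u : R) (l a b : nat) (v m : seq nat) (ys : seq R).

Definition tile_weight u (t : tile) : R :=
  match t with Blank => u - 1 | UpElbow => u | _ => 1 end.

(* K receives the labels leaving through the top and the label leaving on the
   right. *)
Fixpoint row_sum x l ys v (K : seq nat -> nat -> R) : R :=
  match ys, v with
  | y :: ys', b :: v' =>
    \sum_(t : tile | fits t l b) tile_weight (x * y) t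
      * row_sum x (tile_out t l b).1 ys' v' (fun m => K ((tile_out t l b).2 :: m))
  | _, _ => K [::] l
  end.

Lemma eq_row_sum x l ys v K K' :
  (forall m r, K m r = K' m r) -> row_sum x l ys v K = row_sum x l ys v K'.
Proof.
elim: ys l v K K' => [|y ys IH] l [|b v] K K' eqK //=.
by apply: eq_bigr => t _; congr (_ * _); apply: IH.
Qed.

(* Two tiles in the same column: x, lt, t belong to the upper one and x', lb, t'
   to the lower one. *)
Definition column_sum x x' y lt lb b (K : nat -> nat -> nat -> R) : R :=
  \sum_(t' : tile | fits t' lb b) tile_weight (x' * y) t' *
    \sum_(t : tile | fits t lt (tile_out t' lb b).2) tile_weight (x * y) t *
      K (tile_out t lt (tile_out t' lb b).2).1 (tile_out t' lb b).1
        (tile_out t lt (tile_out t' lb b).2).2.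

(* An R-matrix acting on the labels (top, bottom) of two adjacent rows; next to
   a nonzero label, the dummy label 0 behaves as a label larger than all others. *)
Definition Rmatrix x x' (k : nat -> nat -> R) (a b : nat) : R :=
  if (a == 0%N) && (b == 0%N) then x * k 0%N 0%N
  else if (a != 0%N) && ((b == 0%N) || (a <= b)%N)
  then x * k a b - (x - x') * k b a
  else x' * k a b.

(** The R-matrix passes through one column and interchanges the row parameters. Labels matter only
    through their vanishing and relative order, so this is a finite check. *)
Lemma yang_baxter x x' y lt lb b K :
  column_sum x x' y lt lb b (fun rt rb t => Rmatrix x x' (fun a c => K a c t) rt rb) =
  Rmatrix x x' (fun a c => column_sum x' x y a c b K) lt lb.
Proof.
rewrite /column_sum !big_tile.
case: lt lb b => [|lt] [|lb] [|b] /=; rewrite /Rmatrix /= !big_tile /= ?minnSS ?maxnSS /=.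
all: rewrite /minn /maxn ?ltnS; try ring.
(* Splits on the relative order of the positive labels; [lia] discards the inconsistent orders. *)
all: repeat (match goal with
  | |- context [(?a < ?b)%N] => is_var a; is_var b; case: (ltngtP a b) => ? //=
  | |- context [(?a <= ?b)%N] => is_var a; is_var b; case: (ltngtP a b) => ? //=
  end; rewrite ?ltnS; subst; rewrite ?leqnn ?ltnn /=).
all: first [ring | lia].
Qed.

Lemma row_sum_linear x l ys v (I : finType) (P : pred I) (c : I -> R)
    (F : I -> seq nat -> nat -> R) :
  row_sum x l ys v (fun m r => \sum_(i | P i) c i * F i m r) =
  \sum_(i | P i) c i * row_sum x l ys v (F i).
Proof.
elim: ys l v F => [|y ys IH] l [|b v] F //=.
under eq_bigr => t _ do rewrite IH big_distrr /=.
rewrite exchange_big /=; apply: eq_bigr => i _.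
by rewrite big_distrr /=; apply: eq_bigr => t _; rewrite mulrCA.
Qed.

Lemma row_sum_linear2 x l ys v c c' F F' :
  row_sum x l ys v (fun m r => c * F m r + c' * F' m r) =
  c * row_sum x l ys v F + c' * row_sum x l ys v F'.
Proof.
pose G (i : bool) := if i then F else F'.
have := @row_sum_linear x l ys v _ xpredT (fun i : bool => if i then c else c') G.
rewrite big_bool /= => <-; apply: eq_row_sum => m r.
by rewrite big_bool.
Qed.

Lemma row_sum_scale x l ys v c F :
  row_sum x l ys v (fun m r => c * F m r) = c * row_sum x l ys v F.
Proof.
have /= := row_sum_linear2 x l ys v c 0 F F.
by rewrite mul0r addr0 => <-; apply: eq_row_sum => m r; rewrite mul0r addr0.
Qed.

Fixpoint double_row_sum x x' lt lb ys v (K : seq nat -> nat -> nat -> R) : R :=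
  match ys, v with
  | y :: ys', b :: v' =>
    column_sum x x' y lt lb b
      (fun rt rb t => double_row_sum x x' rt rb ys' v' (fun m => K (t :: m)))
  | _, _ => K [::] lt lb
  end.

Lemma eq_column_sum x x' y lt lb b K K' :
  (forall rt rb t, K rt rb t = K' rt rb t) ->
  column_sum x x' y lt lb b K = column_sum x x' y lt lb b K'.
Proof.
move=> eqK; rewrite /column_sum; apply: eq_bigr => t' _; congr (_ * _).
by apply: eq_bigr => t _; rewrite eqK.
Qed.

Lemma eq_double_row_sum x x' lt lb ys v K K' :
  (forall m rt rb, K m rt rb = K' m rt rb) ->
  double_row_sum x x' lt lb ys v K = double_row_sum x x' lt lb ys v K'.
Proof.
elim: ys lt lb v K K' => [|y ys IH] lt lb [|b v] K K' eqK //=.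
by apply: eq_column_sum => rt rb t; apply: IH => m rt' rb'.
Qed.

(** Two rows may be summed column by column, as the R-matrix requires, or row by row, as in
    [grid_sum]. *)
Lemma double_row_sumE x x' lt lb ys v K :
  double_row_sum x x' lt lb ys v K =
  row_sum x' lb ys v (fun m rb => row_sum x lt ys m (fun m' rt => K m' rt rb)).
Proof.
elim: ys lt lb v K => [|y ys IH] lt lb [|b v] K //=.
rewrite /column_sum; apply: eq_bigr => t' _; congr (_ * _).
by rewrite row_sum_linear; apply: eq_bigr => t _; rewrite IH.
Qed.

Lemma double_row_sum_linear2 x x' lt lb ys v c c' F F' :
  double_row_sum x x' lt lb ys v (fun m rt rb => c * F m rt rb + c' * F' m rt rb) =
  c * double_row_sum x x' lt lb ys v F + c' * double_row_sum x x' lt lb ys v F'.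
Proof.
rewrite !double_row_sumE -row_sum_linear2; apply: eq_row_sum => m rb.
exact: (row_sum_linear2 x lt ys m c c' (fun m' rt => F m' rt rb)
  (fun m' rt => F' m' rt rb)).
Qed.

Lemma double_row_sum_Rmatrix x x' lt lb ys v K :
  double_row_sum x x' lt lb ys v (fun m => Rmatrix x x' (K m)) =
  Rmatrix x x' (fun a b => double_row_sum x' x a b ys v K) lt lb.
Proof.
elim: ys lt lb v K => [|y ys IH] lt lb [|b v] K //=.
by rewrite -yang_baxter; apply: eq_column_sum => rt rb t; rewrite IH.
Qed.

(* Rows are listed from the bottom, each with the label it must emit on the
   right. *)
Fixpoint grid_sum ys (rows : seq (R * nat)) v : R :=
  if rows is (x, a) :: rows' then
    row_sum x 0 ys v (fun m r => (r == a)%:R * grid_sum ys rows' m)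
  else (all (pred1 0%N) v)%:R.

(** Both rows start with label 0, where the R-matrix is the scalar [x]; at the right end, the
    prescribed exits [a] and [b] select the two other terms. *)
Lemma grid_sum_exchange ys x x' a b rows v : (0 < b < a)%N ->
  (x - x') * grid_sum ys ((x', a) :: (x, b) :: rows) v =
  x' * grid_sum ys ((x', b) :: (x, a) :: rows) v
  - x * grid_sum ys ((x, b) :: (x', a) :: rows) v.
Proof.
move=> /andP[b_gt0 ltba] /=.
(* Here [c] is the exit prescribed for the upper row and [d] that for the lower row. *)
pose k c d m (rt rb : nat) : R :=
    ((rt == c) && (rb == d))%:R * grid_sum ys rows m.
have E2 c d y y' : row_sum y' 0 ys v (fun m r => (r == d)%:R *
    row_sum y 0 ys m (fun m r => (r == c)%:R * grid_sum ys rows m)) =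
    double_row_sum y y' 0 0 ys v (k c d).
  rewrite double_row_sumE; apply: eq_row_sum => m r; rewrite -row_sum_scale.
    by apply: eq_row_sum => m' r'; rewrite /k mulrA -natrM mulnb andbC.
rewrite !E2; have := double_row_sum_Rmatrix x x' 0 0 ys v (k a b).
rewrite {2}/Rmatrix /= => <-.
(* As [0 < b < a], the exits [(a, b)], top first, fall in the last branch of [Rmatrix] and [(b, a)]
   in the second; elsewhere both sides vanish. *)
rewrite [X in _ = _ - X](@eq_double_row_sum _ _ _ _ _ _ _
  (fun m rt rb => x' * k a b m rt rb + - (x - x') * k b a m rt rb)); last first.
  move=> m p q; rewrite /Rmatrix /k.
  case: ifP => [/andP[/eqP -> /eqP ->]|_].
    have -> : (0%N == b) = false by lia.
    by rewrite andbF /=; ring.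
  case: ifP => asc.
    have -> : (p == a) && (q == b) = false by apply/negP => /andP[/eqP pa /eqP qb]; lia.
    by rewrite (andbC (q == a)) /=; ring.
  have -> : (p == b) && (q == a) = false by apply/negP => /andP[/eqP pb /eqP qa]; lia.
  by rewrite /=; ring.
by rewrite double_row_sum_linear2; ring.
Qed.

Lemma grid_sum_exchange_cat ys x x' a b rows' rows v : (0 < b < a)%N ->
  (x - x') * grid_sum ys (rows' ++ (x', a) :: (x, b) :: rows) v =
  x' * grid_sum ys (rows' ++ (x', b) :: (x, a) :: rows) v
  - x * grid_sum ys (rows' ++ (x, b) :: (x', a) :: rows) v.
Proof.
move=> ltba; elim: rows' v => [|[z c] rows' IH] v; first exact: grid_sum_exchange.
rewrite !cat_cons /= -mulNr -row_sum_linear2 -row_sum_scale.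
by apply: eq_row_sum => m r; rewrite mulrCA IH; ring.
Qed.

(** Only a crossing has both a left and a bottom edge, and the smaller label continues to the right,
    so the whole row is forced. *)
Lemma row_sum_cross x l ys v K : (0 < l)%N -> size ys = size v ->
  all (fun b => l < b)%N v -> row_sum x l ys v K = K v l.
Proof.
move=> l0; elim: ys v K => [|y ys IH] [|b v] K //= [eqs] /andP[lb lv].
rewrite big_tile /fits /= -!lt0n l0 (ltn_trans l0 lb) /= mul1r.
rewrite (minn_idPl (ltnW lb)) (maxn_idPr (ltnW lb)) IH // ; ring.
Qed.

(** Tiles never create a positive label, so [a] cannot leave a row that it has not entered. *)
Lemma row_sum_absent x a l ys v F : (0 < a)%N -> a != l -> a \notin v ->
  row_sum x l ys v (fun m r => (r == a)%:R * F m r) = 0.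
Proof.
move=> a0; elim: ys l v F => [|y ys IH] l [|b v] F al av /=.
1-3: by rewrite eq_sym (negPf al) mul0r.
move: av; rewrite inE negb_or => /andP[ab av].
apply: big1 => t _; rewrite IH ?mulr0 //.
case: t => //=; rewrite -?lt0n //; lia.
Qed.

(** Blanks are forced up to the column where [a] enters; there its pipe must turn right, and from
    then on it crosses every other pipe. *)
Lemma row_sum_staircase x ys1 y ys2 v a F : size ys2 = size v -> (0 < a)%N ->
  all (fun b => a < b)%N v ->
  row_sum x 0 (ys1 ++ y :: ys2) (nseq (size ys1) 0%N ++ a :: v)
    (fun m r => (r == a)%:R * F m) =
  (\prod_(z <- ys1) (x * z - 1)) * F (nseq (size ys1).+1 0%N ++ v).
Proof.
move=> eqs a0 av; elim: ys1 F => [|z ys1 IH] F /=; rewrite big_tile /fits /=.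
  rewrite -lt0n a0 /= big_nil !addr0 !mul1r row_sum_cross // eqxx mul1r.
  (* A vertical tile would send [a] upwards, and it could no longer exit on the right. *)
  rewrite (row_sum_absent _ _ (fun m _ => F (a :: m))) ?addr0 -?lt0n //.
  by apply/negP => /(allP av); rewrite ltnn.
by rewrite big_cons !add0r !addr0 (IH (fun m => F (0%N :: m))) mulrA.
Qed.

End Lattice.

(** * Bumpless pipe dreams as configurations *)

Fixpoint row_out (l : nat) (ts : seq tile) (v : seq nat) : nat :=
  match ts, v with
  | t :: ts', b :: v' => row_out (tile_out t l b).1 ts' v'
  | _, _ => l
  end.

Fixpoint row_top (l : nat) (ts : seq tile) (v : seq nat) : seq nat :=
  match ts, v with
  | t :: ts', b :: v' => (tile_out t l b).2 :: row_top (tile_out t l b).1 ts' v'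
  | _, _ => [::]
  end.

Fixpoint row_fits (l : nat) (ts : seq tile) (v : seq nat) : bool :=
  match ts, v with
  | t :: ts', b :: v' => fits t l b && row_fits (tile_out t l b).1 ts' v'
  | _, _ => true
  end.

(** Rows come from the bottom, as in [grid_sum]; the last clause keeps pipes off the top
    boundary. *)
Fixpoint grid_fits (T : seq (seq tile)) (es v : seq nat) : bool :=
  match T, es with
  | ts :: T', e :: es' =>
    [&& row_fits 0 ts v, row_out 0 ts v == e & grid_fits T' es' (row_top 0 ts v)]
  | _, _ => all (pred1 0%N) v
  end.

Lemma row_fits_rcons l ts t v b : size ts = size v ->
  row_fits l (rcons ts t) (rcons v b) =
  row_fits l ts v && fits t (row_out l ts v) b.
Proof.
elim: ts l v => [|t' ts IH] l [|b' v] //=; first by rewrite andbT.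
by move=> [eqs]; rewrite IH // andbA.
Qed.

Lemma row_out_rcons l ts t v b : size ts = size v ->
  row_out l (rcons ts t) (rcons v b) = (tile_out t (row_out l ts v) b).1.
Proof. by elim: ts l v => [|t' ts IH] l [|b' v] //= [eqs]; rewrite IH. Qed.

Lemma row_top_rcons l ts t v b : size ts = size v ->
  row_top l (rcons ts t) (rcons v b) =
  rcons (row_top l ts v) (tile_out t (row_out l ts v) b).2.
Proof. by elim: ts l v => [|t' ts IH] l [|b' v] //= [eqs]; rewrite IH. Qed.

Lemma size_row_top l ts v : size ts = size v -> size (row_top l ts v) = size v.
Proof. by elim: ts l v => [|t' ts IH] l [|b' v] //= [eqs]; rewrite IH. Qed.

Section RowLabel.
Variables (t : nat -> tile) (v : nat -> nat).

Lemma row_out_mkseq n : row_out 0 (mkseq t n) (mkseq v n) = row_label t v n.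
Proof.
by elim: n => [|n IH] //; rewrite !mkseqS row_out_rcons ?size_mkseq // IH.
Qed.

Lemma row_top_mkseq n : row_top 0 (mkseq t n) (mkseq v n) =
  mkseq (fun j => (tile_out (t j) (row_label t v j) (v j)).2) n.
Proof.
elim: n => [|n IH] //; rewrite !mkseqS row_top_rcons ?size_mkseq // IH.
by rewrite row_out_mkseq.
Qed.

Lemma row_fits_mkseq n : row_fits 0 (mkseq t n) (mkseq v n) =
  all (fun j => fits (t j) (row_label t v j) (v j)) (iota 0 n).
Proof.
elim: n => [|n IH] //; rewrite !mkseqS row_fits_rcons ?size_mkseq // IH.
by rewrite row_out_mkseq -addn1 iotaD all_cat /= andbT.
Qed.

End RowLabel.

Lemma grid_fits_iota (f : nat -> seq tile) (e : nat -> nat) (V : nat -> seq nat) s m :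
  (forall k, V k.+1 = row_top 0 (f k) (V k)) ->
  grid_fits [seq f k | k <- iota s m] [seq e k | k <- iota s m] (V s) =
  all (fun k => row_fits 0 (f k) (V k) && (row_out 0 (f k) (V k) == e k)) (iota s m)
  && all (pred1 0%N) (V (s + m)%N).
Proof.
move=> VS; elim: m s => [|m IH] s /=; first by rewrite addn0.
by rewrite -VS IH addSnnS !andbA.
Qed.

(** The row [k] above the bottom has index [n - k.+1] from the top; this passes between the two
    numberings. *)
Lemma map_rev_enum n (T : Type) (F : 'I_n -> T) (F' : nat -> T) :
  (forall i : 'I_n, F' i = F i) ->
  [seq F i | i <- rev (enum 'I_n)] = [seq F' (n - k.+1)%N | k <- iota 0 n].
Proof.
move=> FF'; under eq_map => i do rewrite -FF'.
rewrite (map_comp F' val) map_rev val_enum_ord.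
rewrite (map_comp F' (fun k => n - k.+1)%N); congr map.
apply: (@eq_from_nth _ 0%N) => [|i]; rewrite size_rev size_iota ?size_map ?size_iota //.
move=> ltin; rewrite nth_rev size_iota // (nth_map 0%N) ?size_iota // !nth_iota //; lia.
Qed.

(** * Bumpless pipe dreams described by their labels *)

Section Matrix.

Variable n : nat.
Implicit Types (P : 'M[tile]_n) (w : 'S_n).

Lemma tile_at_ord P (i j : 'I_n) : tile_at P i j = P i j.
Proof. by rewrite /tile_at !valK. Qed.

Definition left_label P k := row_label (tile_at P (n - k.+1)) (col_label P k).

Lemma fits_right t l b : fits t l b -> ((tile_out t l b).1 != 0%N) = right_edge t.
Proof. by case: t l b => [] [|l] [|b] //=; rewrite minnSS. Qed.

Lemma fits_top t l b : fits t l b -> ((tile_out t l b).2 != 0%N) = top_edge t.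
Proof. by case: t l b => [] [|l] [|b] //=; rewrite maxnSS. Qed.

(** The other boundary conditions are built into the labels: they are [j.+1] at the bottom, 0 on the
    left, and the exits [(w i).+1] are nonzero. *)
Definition fitted P w : Prop :=
  [/\ forall k j, (k < n)%N -> (j < n)%N ->
        fits (tile_at P (n - k.+1) j) (left_label P k j) (col_label P k j),
      forall i : 'I_n, left_label P (n - i.+1) n = (w i).+1 &
      forall j, (j < n)%N -> col_label P n j = 0%N].

Lemma is_bpdP P : reflect
  [/\ [/\ forall i j, (i < n)%N -> (j.+1 < n)%N ->
        right_edge (tile_at P i j) = left_edge (tile_at P i j.+1),
      forall i j, (i.+1 < n)%N -> (j < n)%N ->
        bottom_edge (tile_at P i j) = top_edge (tile_at P i.+1 j) &
      forall j, (j < n)%N -> bottom_edge (tile_at P n.-1 j)],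
      forall i, (i < n)%N -> right_edge (tile_at P i n.-1),
      forall i, (i < n)%N -> left_edge (tile_at P i 0) = false &
      forall j, (j < n)%N -> top_edge (tile_at P 0 j) = false]
  (is_bpd P).
Proof.
apply: (iffP idP).
  case/and5P => /forallP h1 /forallP h2 /forallP h3 /forallP h4.
  case/andP => /forallP h5 /forallP h6.
  split; first split.
  - move=> i j lti ltj; have := h1 (Ordinal lti) => /forallP/(_ (Ordinal (ltnW ltj))).
    by move=> /forallP/(_ (Ordinal ltj)); rewrite eqxx -!tile_at_ord => /eqP.
  - move=> i j lti ltj; have := h2 (Ordinal (ltnW lti)) => /forallP/(_ (Ordinal lti)).
    by move=> /forallP/(_ (Ordinal ltj)); rewrite eqxx -!tile_at_ord => /eqP.
  - move=> j ltj; have lt0 : (n.-1 < n)%N by lia.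
    have := h3 (Ordinal lt0) => /forallP/(_ (Ordinal ltj)) /implyP.
    by rewrite -tile_at_ord /=; apply; apply/eqP; lia.
  - move=> j ltj; have lt0 : (n.-1 < n)%N by lia.
    have := h4 (Ordinal ltj) => /forallP/(_ (Ordinal lt0)) /implyP.
    by rewrite -tile_at_ord /=; apply; apply/eqP; lia.
  - move=> j ltj; have lt0 : (0 < n)%N by lia.
    have := h5 (Ordinal ltj) => /forallP/(_ (Ordinal lt0)) /implyP.
    by rewrite -tile_at_ord /= => /(_ isT) /negPf.
  - move=> j ltj; have lt0 : (0 < n)%N by lia.
    have := h6 (Ordinal lt0) => /forallP/(_ (Ordinal ltj)) /implyP.
    by rewrite -tile_at_ord /= => /(_ isT) /negPf.
case=> [[h1 h2 h3] h4 h5 h6]; apply/and5P; split; last (apply/andP; split).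
- apply/forallP => i; apply/forallP => j; apply/forallP => j'; apply/implyP => /eqP e.
  by rewrite -!tile_at_ord e h1 // -e.
- apply/forallP => i; apply/forallP => i'; apply/forallP => j; apply/implyP => /eqP e.
  by rewrite -!tile_at_ord e h2 // -e.
- apply/forallP => i; apply/forallP => j; apply/implyP => /eqP e.
  by rewrite -tile_at_ord (_ : i = n.-1 :> nat) ?h3 //; lia.
- apply/forallP => i; apply/forallP => j; apply/implyP => /eqP e.
  by rewrite -tile_at_ord (_ : j = n.-1 :> nat) ?h4 //; lia.
- apply/forallP => i; apply/forallP => j; apply/implyP => /eqP e.
  by rewrite -tile_at_ord e h5.
- apply/forallP => i; apply/forallP => j; apply/implyP => /eqP e.
  by rewrite -tile_at_ord e h6.
Qed.

(** An edge carries a pipe exactly when its label is nonzero; given this, matching edges and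
    matching labels amount to the same. *)
Lemma fittedP P w : reflect (fitted P w) (is_bpd P && has_demazure P w).
Proof.
have exitE (i : 'I_n) : exit_label P i = left_label P (n - i.+1) n.
  have lti := ltn_ord i; rewrite /exit_label /left_label.
  by rewrite (_ : n - (n - i.+1).+1 = i)%N //; lia.
apply: (iffP andP) => [[/is_bpdP [[h1 h2 h3] h4 h5 h6] /forallP dem]|[fit dem top]].
  (* Once the bottom edges of a row are known, its left edges are settled from left to right. *)
  have bottom k j : (k < n)%N -> (j < n)%N ->
      (forall j', (j' < n)%N -> 
        bottom_edge (tile_at P (n - k.+1) j') = (col_label P k j' != 0%N)) ->
      fits (tile_at P (n - k.+1) j) (left_label P k j) (col_label P k j).
    move=> ltk ltj bot; elim: j ltj => [|j IH] ltj.
      by rewrite /fits bot // eqxx h5 //; lia.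
    rewrite /fits bot // eqxx andbT -h1 //; last by lia.
    by rewrite -(fits_right (IH (ltnW ltj))).
  (* Bottom edges are settled row by row upwards, through the top edges of the row below. *)
  have bot k : (k < n)%N -> forall j, (j < n)%N ->
      bottom_edge (tile_at P (n - k.+1) j) = (col_label P k j != 0%N).
    elim: k => [|k IH] ltk j ltj; first by rewrite subn1 h3.
    rewrite h2 //; last by lia.
    have -> : (n - k.+2).+1 = (n - k.+1)%N by lia.
    by rewrite -(fits_top (bottom _ _ (ltnW ltk) ltj (IH (ltnW ltk)))).
  split => [k j ltk ltj|i|j ltj]; first exact: bottom (bot k ltk).
    by rewrite -exitE; apply/eqP.
  have n0 : (n.-1 < n)%N by lia.
  have := fits_top (bottom _ _ n0 ltj (bot _ n0)).
  have eqn : n = n.-1.+1 by lia.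
  rewrite /left_label -eqn subnn h6 // => /negPn/eqP.
  have -> : col_label P n j = col_label P n.-1.+1 j by rewrite -eqn.
  by rewrite /= -eqn subnn.
split; last by apply/forallP => i; rewrite exitE dem.
(* Conversely, all four edges of each tile are read off from the labels. *)
have edges i j : (i < n)%N -> (j < n)%N ->
    fits (tile_at P i j) (left_label P (n - i.+1) j) (col_label P (n - i.+1) j).
  move=> lti ltj; have := fit (n - i.+1)%N j.
  rewrite (_ : n - (n - i.+1).+1 = i)%N; last lia.
  by apply => //; lia.
have right i j : (i < n)%N -> (j < n)%N ->
    right_edge (tile_at P i j) = (left_label P (n - i.+1) j.+1 != 0%N).
  move=> lti ltj; rewrite -(fits_right (edges i j lti ltj)) /left_label /=.
  by rewrite (_ : n - (n - i.+1).+1 = i)%N //; lia.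
have left i j : (i < n)%N -> (j < n)%N ->
    left_edge (tile_at P i j) = (left_label P (n - i.+1) j != 0%N).
  by move=> lti ltj; have /andP[/eqP] := edges i j lti ltj.
have bot i j : (i < n)%N -> (j < n)%N ->
    bottom_edge (tile_at P i j) = (col_label P (n - i.+1) j != 0%N).
  by move=> lti ltj; have /andP[_ /eqP] := edges i j lti ltj.
have topE i j : (i < n)%N -> (j < n)%N ->
    top_edge (tile_at P i j) = (col_label P (n - i) j != 0%N).
  move=> lti ltj; rewrite -(fits_top (edges i j lti ltj)) /left_label.
  rewrite (_ : n - (n - i.+1).+1 = i)%N; last lia.
  rewrite (_ : n - i = (n - i.+1).+1)%N /=; last lia.
  by rewrite (_ : n - (n - i.+1).+1 = i)%N //; lia.
apply/is_bpdP; split; first split.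
- by move=> i j lti ltj; rewrite right // ?left //; lia.
- by move=> i j lti ltj; rewrite bot // ?topE //; lia.
- by move=> j ltj; rewrite bot; [rewrite (_ : n - n.-1.+1 = 0)%N //; lia|lia|lia].
- move=> i lti; rewrite right //; last lia.
  rewrite (_ : n.-1.+1 = n); last lia.
  by rewrite (dem (Ordinal lti)).
- by move=> i lti; rewrite left //; lia.
- by move=> j ltj; rewrite topE ?subn0 ?top //; lia.
Qed.

Definition tiles_of P : n.-tuple (n.-tuple tile) :=
  [tuple of [seq [tuple of [seq P i j | j <- ord_tuple n]] | i <- rev (ord_tuple n)]].

Definition exits w := [seq (w i).+1 | i <- rev (enum 'I_n)].

Lemma tiles_of_bij : bijective tiles_of.
Proof.
apply: inj_card_bij; last by rewrite card_mx !card_tuple expnM.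
move=> P Q /(congr1 val) /= /eq_in_map eqPQ; apply/matrixP => i j.
have /eqPQ : i \in rev (enum 'I_n) by rewrite mem_rev mem_enum.
by move=> /(congr1 val) /= /eq_in_map; apply; rewrite mem_enum.
Qed.

Lemma grid_fits_tiles_of P w :
  grid_fits [seq val ts | ts <- tiles_of P] (exits w) (iota 1 n) =
  is_bpd P && has_demazure P w.
Proof.
(* Tiles, prescribed exit and incoming labels of the row [k] above the bottom; the default 0 in [e]
   is not reached for [k < n]. *)
pose f k := mkseq (tile_at P (n - k.+1)) n.
pose e k := oapp (fun i : 'I_n => (w i).+1) 0%N (insub (n - k.+1)%N).
pose V k := mkseq (col_label P k) n.
have VS k : V k.+1 = row_top 0 (f k) (V k) by rewrite row_top_mkseq.
have -> : exits w = [seq e k | k <- iota 0 n].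
  apply: (@map_rev_enum _ _ _ (fun i => oapp (fun i : 'I_n => (w i).+1) 0%N (insub i))).
  by move=> i; rewrite valK.
have -> : [seq val ts | ts <- tiles_of P] = [seq f k | k <- iota 0 n].
  rewrite -map_comp /=.
  apply: (@map_rev_enum _ _ _ (fun i => mkseq (tile_at P i) n)) => i /=.
  rewrite /mkseq -val_enum_ord -map_comp; apply: eq_map => j /=.
  exact: tile_at_ord.
have -> : iota 1 n = V 0%N.
  by rewrite /V /mkseq /= -[1%N]addn0 iotaDl; apply: eq_map => j; rewrite add1n.
rewrite grid_fits_iota // add0n.
apply/idP/fittedP => [/andP[/allP fit /allP top]|[fit dem top]].
  have fit' k : (k < n)%N -> row_fits 0 (f k) (V k) && (row_out 0 (f k) (V k) == e k).
    by move=> ltk; apply: fit; rewrite mem_iota.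
  split.
  - move=> k j ltk ltj; have /andP[+ _] := fit' k ltk.
    by rewrite row_fits_mkseq => /allP; apply; rewrite mem_iota.
  - move=> i; have lti := ltn_ord i; have /andP[_ /eqP] := fit' (n - i.+1)%N ltac:(lia).
    rewrite row_out_mkseq /e; have -> : (n - (n - i.+1).+1 = i)%N by lia.
    rewrite valK /= => <-; rewrite /left_label.
    by have -> : (n - (n - i.+1).+1 = i)%N by lia.
  - by move=> j ltj; apply/eqP/top/mapP; exists j => //; rewrite mem_iota.
apply/andP; split; last first.
  by apply/allP => _ /mapP[j + ->]; rewrite mem_iota => /andP[_ ?]; apply/eqP/top.
apply/allP => k; rewrite mem_iota add0n => /andP[_ ltk].
rewrite row_fits_mkseq row_out_mkseq; apply/andP; split.
  by apply/allP => j; rewrite mem_iota => /andP[_ ltj]; apply: fit.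
have lti : (n - k.+1 < n)%N by lia.
rewrite /e (insubT (fun i => i < n)%N lti) /= -dem /left_label /=.
by have -> : (n - (n - k.+1).+1 = k)%N by lia.
Qed.

End Matrix.

(** * Expansion of the partition function over tilings *)

Lemma big_tuple_cons (R : nmodType) (T : finType) n (P : pred (seq T)) (F : seq T -> R) :
  \sum_(s : n.+1.-tuple T | P s) F s =
  \sum_(t : T) \sum_(s : n.-tuple T | P (t :: s)) F (t :: s).
Proof.
rewrite pair_big_dep /=.
rewrite (reindex (fun p : T * n.-tuple T => [tuple of p.1 :: p.2])) //=.
exists (fun s : n.+1.-tuple T => (thead s, [tuple of behead s])) => [[t s] _|s _] /=.
  by congr (_, _); apply: val_inj.
by rewrite -tuple_eta.
Qed.

Section Expansion.

Variable R : comNzRingType.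
Implicit Types (x : R) (ys : seq R).

Lemma row_sum_tuple n x l ys v (K : seq nat -> nat -> R) : size ys = n -> size v = n ->
  row_sum x l ys v K =
  \sum_(ts : n.-tuple tile | row_fits l ts v)
    (\prod_(p <- zip ys ts) tile_weight (x * p.1) p.2)
      * K (row_top l ts v) (row_out l ts v).
Proof.
move=> <-; elim: ys l v K => [|y ys IH] l [|b v] K //= eqs.
  rewrite (big_pred1 [tuple]) => [|s]; last by rewrite [s]tuple0.
  by rewrite big_nil mul1r.
move: eqs => [eqs].
rewrite (big_tuple_cons _ (fun ts => row_fits l ts (b :: v))
  (fun ts => (\prod_(p <- zip (y :: ys) ts) tile_weight (x * p.1) p.2) *
     K (row_top l ts (b :: v)) (row_out l ts (b :: v)))) /=.
rewrite [LHS]big_mkcond; apply: eq_bigr => t _.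
case: ifP => ft; last by rewrite big_pred0.
rewrite IH // big_distrr /=; apply: eq_bigr => ts _.
by rewrite big_cons mulrA.
Qed.

Lemma grid_sum_tuple k n ys (rows : seq (R * nat)) v :
  size rows = k -> size ys = n -> size v = n ->
  grid_sum ys rows v =
  \sum_(T : k.-tuple (n.-tuple tile)
      | grid_fits [seq val ts | ts <- T] (unzip2 rows) v)
    \prod_(p <- zip (unzip1 rows) T) \prod_(q <- zip ys p.2) tile_weight (p.1 * q.1) q.2.
Proof.
move=> <- eqys; elim: rows v => [|[x a] rows IH] v eqv /=.
  rewrite [RHS]big_mkcond (big_pred1 [tuple]) => [|s]; last by rewrite [s]tuple0.
  by rewrite big_nil /=; case: (all _ _).
rewrite (big_tuple_cons _
  (fun T : seq (n.-tuple tile) =>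
    grid_fits [seq val ts | ts <- T] (a :: unzip2 rows) v)
  (fun T : seq (n.-tuple tile) => \prod_(p <- zip (x :: unzip1 rows) T)
    \prod_(q <- zip ys p.2) tile_weight (p.1 * q.1) q.2)) /=.
rewrite (row_sum_tuple _ _ _ eqys eqv) big_mkcond; apply: eq_bigr => ts _.
case: ifP => fit /=; last by rewrite big_pred0.
have [outE|] := eqVneq (row_out 0 ts v) a; last by rewrite mul0r mulr0 big_pred0.
rewrite mul1r IH ?size_row_top ?size_tuple // big_distrr /=.
by apply: eq_bigr => T _; rewrite big_cons.
Qed.

Variable n : nat.
Implicit Types (X Y : 'I_n -> R) (w : 'S_n).

(** The partition function Z(w), with row parameters [X] and column parameters [Y]. *)
Definition pipe_sum X Y w : R :=
  \sum_(P in Pipes w) \prod_(i < n) \prod_(j < n) tile_weight (X i * Y j) (P i j).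

Definition rows X w := [seq (X i, (w i).+1) | i <- rev (enum 'I_n)].

Lemma pipe_sumE X Y w :
  pipe_sum X Y w = grid_sum [seq Y j | j <- enum 'I_n] (rows X w) (iota 1 n).
Proof.
rewrite (@grid_sum_tuple n n) ?size_map ?size_rev -?enumT ?size_enum_ord ?size_iota //.
rewrite (reindex _ (onW_bij _ (tiles_of_bij n))) /=.
have -> : unzip2 (rows X w) = exits w by rewrite /unzip2 -map_comp.
apply: eq_big => P; first by rewrite grid_fits_tiles_of inE.
move=> _; rewrite /unzip1 -map_comp /=.
rewrite zip_map big_map [RHS](perm_big (enum 'I_n)) ?perm_rev //= big_enum /=.
apply: eq_bigr => i _.
by rewrite zip_map big_map /= big_enum.
Qed.

(** Rows [j] and [i] are consecutive in the list of rows, the lower one first; the local exchange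
    applies to them, and [tperm i j] fixes all other rows. *)
Lemma pipe_sum_exchange X Y w (i j : 'I_n) : j = i.+1 :> nat -> (w j < w i)%N ->
  (X i - X j) * pipe_sum X Y (tperm i j * w)%g =
  X j * pipe_sum X Y w - X i * pipe_sum (X \o tperm i j) Y w.
Proof.
move=> eqj ltw; rewrite !pipe_sumE /rows.
have [p [q Epq]] : exists p q, rev (enum 'I_n) = p ++ j :: i :: q.
  exists (rev (drop j.+1 (enum 'I_n))), (rev (take i (enum 'I_n))).
  rewrite -{1}(cat_take_drop i (enum 'I_n)).
  rewrite (drop_nth i) ?size_enum_ord // nth_ord_enum -eqj.
  rewrite (drop_nth i) ?size_enum_ord // nth_ord_enum.
  by rewrite rev_cat !rev_cons -!cats1 -!catA.
have : uniq (rev (enum 'I_n)) by rewrite rev_uniq enum_uniq.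
rewrite Epq cat_uniq /= inE !negb_or.
case/and3P => _ /and3P[jp ip _] /and3P[/andP[_ jq] iq _].
have fixed (S : Type) (f : 'I_n -> 'I_n -> S) (s : seq 'I_n) : i \notin s -> j \notin s ->
    [seq f k (tperm i j k) | k <- s] = [seq f k k | k <- s].
  move=> ni nj; apply/eq_in_map => k ks; rewrite tpermD //.
  - by apply: contraNneq ni => ->.
  - by apply: contraNneq nj => ->.
rewrite !map_cat /= !permM tpermL tpermR.
have Ew s : i \notin s -> j \notin s ->
   [seq (X k, ((tperm i j * w)%g k).+1) | k <- s] = [seq (X k, (w k).+1) | k <- s].
  move=> ni nj; rewrite -(fixed _ (fun k k' => (X k, (w k').+1))) //.
  by apply: eq_map => k; rewrite permM.
have EX s : i \notin s -> j \notin s ->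
   [seq (X (tperm i j k), (w k).+1) | k <- s] = [seq (X k, (w k).+1) | k <- s].
  by move=> ni nj; rewrite -(fixed _ (fun k k' => (X k', (w k).+1))).
rewrite !Ew // !EX //.
by rewrite grid_sum_exchange_cat //= ltnS ltw.
Qed.

(** Above the lowest [k] rows, the labels up to [k] have left and the first [k] columns are empty,
    so [row_sum_staircase] forces the next row. *)
Lemma grid_sum_staircase n' ys (x : nat -> R) k m : size ys = n' -> (k + m)%N = n' ->
  grid_sum ys [seq (x i, i.+1) | i <- iota k m] (nseq k 0%N ++ iota k.+1 m) =
  \prod_(i <- iota k m) \prod_(y <- take i ys) (x i * y - 1).
Proof.
move=> eqys; elim: m k => [|m IH] k eqkm /=.
  by rewrite big_nil cats0 all_nseq orbT.
have ltk : (k < size ys)%N by lia.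
have eqs : size (drop k.+1 ys) = size (iota k.+2 m) by rewrite size_drop size_iota; lia.
have gt : all (fun b => k.+1 < b)%N (iota k.+2 m).
  by apply/allP => b; rewrite mem_iota; lia.
have := @row_sum_staircase _ (x k) (take k ys) (nth 0 ys k) _ _ k.+1
  (grid_sum ys [seq (x i, i.+1) | i <- iota k.+1 m]) eqs isT gt.
rewrite -drop_nth // cat_take_drop size_takel ?(ltnW ltk) // => ->.
by rewrite big_cons IH //; lia.
Qed.

Lemma take_enum_ord k : take k (enum 'I_n) = [seq j : 'I_n <- enum 'I_n | (j < k)%N].
Proof.
apply: (inj_map val_inj).
rewrite map_take val_enum_ord take_iota.
rewrite (eq_filter (a2 := preim val (fun j => j < k)%N)) //.
rewrite -filter_map val_enum_ord.
have [ltkn|lenk] := ltnP k n; first by rewrite -(filter_iota_ltn 0 (ltnW ltkn)).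
rewrite -[LHS]filter_predT; apply/eq_in_filter => j; rewrite mem_iota => /andP[_ ltj].
by rewrite /= (leq_trans ltj lenk).
Qed.

Lemma pipe_sum_longest X Y :
  pipe_sum X Y (longest n) =
  \prod_(i < n) \prod_(j < n | (i.+1 + j.+1 <= n)%N) (X i * Y j - 1).
Proof.
rewrite pipe_sumE.
pose X' i := oapp X 0 (insub i).
have XE (i : 'I_n) : X' i = X i by rewrite /X' valK.
have -> : rows X (longest n) = [seq (X' (n - k.+1)%N, k.+1) | k <- iota 0 n].
  rewrite /rows (@map_rev_enum _ _ _ (fun i => (X' i, (n - i.+1).+1))); last first.
    by move=> i; rewrite XE permE.
  apply/eq_in_map => k; rewrite mem_iota => /andP[_ ltk].
  by congr (_, _.+1); lia.
rewrite (@grid_sum_staircase n _ (fun k => X' (n - k.+1)%N) 0) //; last first.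
  by rewrite size_map size_enum_ord.
pose H (i : 'I_n) := \prod_(j < n | (i.+1 + j.+1 <= n)%N) (X i * Y j - 1).
transitivity (\prod_(h <- [seq H i | i <- rev (enum 'I_n)]) h); last first.
  by rewrite big_map (perm_big (enum 'I_n)) ?perm_rev //= big_enum.
rewrite (@map_rev_enum _ _ _ (fun i =>
  \prod_(y <- take (n - i.+1) [seq Y j | j <- enum 'I_n]) (X' i * y - 1)));
  last first => [i|].
  rewrite /H -map_take big_map take_enum_ord big_filter big_enum_cond XE.
  by apply: eq_bigl => j /=; lia.
rewrite big_map; apply: eq_big_seq => k; rewrite mem_iota => /andP[_ ltk].
by have -> : (n - (n - k.+1).+1 = k)%N by lia.
Qed.
End Expansion.

(** * Coxeter length *)

Section Length.

Variable n : nat.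
Implicit Types (w : 'S_n) (i j : 'I_n).

Definition inversions w : {set 'I_n * 'I_n} :=
  [set p : 'I_n * 'I_n | (p.1 < p.2)%N && (w p.2 < w p.1)%N].

(** No index lies strictly between [i] and [j], so exchanging them can only reverse the pair
    [(i, j)] itself. *)
Lemma tperm_adjacent_lt i j (a b : 'I_n) : j = i.+1 :> nat -> (a < b)%N ->
  (a, b) != (i, j) -> (tperm i j a < tperm i j b)%N.
Proof.
rewrite xpair_eqE => eqj ltab neq.
have val_neq (c d : 'I_n) : c <> d -> c <> d :> nat by move=> cd /val_inj.
case: tpermP => [ai|aj|/val_neq ai /val_neq aj];
  case: tpermP => [bi|bj|/val_neq bi /val_neq bj]; subst; rewrite ?eqxx // in neq *; lia.
Qed.

(** Applying the transposition to both entries of a pair carries the inversions of [w] onto those of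
    the product other than [(i, j)], which is new. *)
Lemma card_inversions_ascent i j w : j = i.+1 :> nat -> (w i < w j)%N ->
  #|inversions (tperm i j * w)%g| = #|inversions w|.+1.
Proof.
move=> eqj ltw; pose s := tperm i j; pose h (p : 'I_n * 'I_n) := (s p.1, s p.2).
have hK : involutive h by case=> a b; rewrite /h /s /= !tpermK.
have lt_ij : (i < j)%N by rewrite eqj.
have -> : inversions (s * w)%g = (i, j) |: (h @: inversions w).
  apply/setP => -[a b]; rewrite !inE /= !permM.
  have [[-> ->]|ne] := eqVneq (a, b) (i, j).
    by rewrite /s tpermL tpermR lt_ij ltw.
  rewrite /=; rewrite -[(a, b)]hK (mem_imset _ _ (inv_inj hK)) inE /=.
  case ltw' : (w (s b) < w (s a))%N; rewrite ?andbF // !andbT.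
  apply/idP/idP => [lt|lt]; first exact: tperm_adjacent_lt.
  rewrite -(tpermK i j a) -(tpermK i j b); apply: tperm_adjacent_lt => //.
  apply/negP => /eqP [sa sb]; move: ltw'; rewrite /s sa sb; lia.
rewrite cardsU1 card_imset ?(inv_inj hK) //; last exact: inv_inj.
rewrite -[(i, j)]hK (mem_imset _ _ (inv_inj hK)) inE /= /s tpermL tpermR.
by rewrite [(j < i)%N]ltnNge (ltnW lt_ij).
Qed.

Lemma card_inversions_descent i j w : j = i.+1 :> nat -> (w j < w i)%N ->
  #|inversions w| = #|inversions (tperm i j * w)%g|.+1.
Proof.
move=> eqj ltw; have := @card_inversions_ascent i j (tperm i j * w)%g eqj.
by rewrite !permM tpermL tpermR mulgA tperm2 mul1g; apply.
Qed.

(** Recovers the values of a permutation from their relative order, which identifies the increasing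
    and the decreasing one. *)
Lemma perm_card_below w i : #|[set k : 'I_n | (w k < w i)%N]| = w i.
Proof.
have -> : [set k : 'I_n | (w k < w i)%N] = w @^-1: [set k : 'I_n | (k < w i)%N].
  by apply/setP => k; rewrite !inE.
rewrite on_card_preimset; last first.
  by exists (w^-1)%g => k _; rewrite ?permK ?permKV.
rewrite -sum1dep_card -(big_ord_widen n (fun=> 1%N)) ?sum_nat_const ?card_ord ?muln1 //.
exact: ltnW.
Qed.

Lemma adjacent_homo (r : rel nat) w : transitive r ->
  (forall i j, j = i.+1 :> nat -> r (w i) (w j)) ->
  forall i j, (i < j)%N -> r (w i) (w j).
Proof.
move=> rtr radj i [j ltj] /=; elim: j ltj => [//|j IH] ltj.
have ltj' := ltnW ltj.
have rj : r (w (Ordinal ltj')) (w (Ordinal ltj)) by apply: radj.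
rewrite ltnS leq_eqVlt => /orP[/eqP eq_ij|lt_ij].
  by have -> : i = Ordinal ltj' by apply: val_inj.
exact: rtr (IH ltj' lt_ij) rj.
Qed.

Lemma increasing_perm w : (forall i j, (i < j)%N -> (w i < w j)%N) -> w = 1%g.
Proof.
move=> incr; apply/permP => i; apply: val_inj; rewrite perm1 /=.
rewrite -[LHS]perm_card_below; have := perm_card_below 1%g i; rewrite perm1 => <-.
apply: eq_card => k; rewrite !inE perm1.
have [lt|lt|/val_inj ->] := ltngtP k i; last by rewrite ltnn.
  exact: incr.
by rewrite ltnNge ltnW ?incr.
Qed.

Lemma decreasing_perm w : (forall i j, (i < j)%N -> (w j < w i)%N) -> w = longest n.
Proof.
move=> decr; apply/permP => i; apply: val_inj.
rewrite -[LHS]perm_card_below -[RHS]perm_card_below.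
apply: eq_card => k; rewrite !inE !permE /=.
have [lt|lt|/val_inj ->] := ltngtP k i; last by rewrite !ltnn.
  by have := decr _ _ lt; have := ltn_ord i; lia.
by rewrite decr //; have := ltn_ord k; lia.
Qed.

Lemma has_descent w : w != 1%g ->
  exists i j, j = i.+1 :> nat /\ (w j < w i)%N.
Proof.
move=> w1.
case: (pickP (fun p : 'I_n * 'I_n => (p.2 == p.1.+1 :> nat) && (w p.2 < w p.1)%N)).
  by move=> [i j] /andP[/eqP eqj lt]; exists i, j.
move=> no; case/eqP: w1; apply: increasing_perm; apply: (@adjacent_homo ltn) ltn_trans _.
move=> i j eqj; have := no (i, j); rewrite /= eqj eqxx /= => /negbT.
rewrite -leqNgt leq_eqVlt => /orP[/eqP/val_inj/perm_inj eqij|//].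
by move: eqj; rewrite eqij; lia.
Qed.

Lemma has_ascent w : w != longest n ->
  exists i j, j = i.+1 :> nat /\ (w i < w j)%N.
Proof.
move=> w1.
case: (pickP (fun p : 'I_n * 'I_n => (p.2 == p.1.+1 :> nat) && (w p.1 < w p.2)%N)).
  by move=> [i j] /andP[/eqP eqj lt]; exists i, j.
move=> no; case/eqP: w1; apply: decreasing_perm.
apply: (@adjacent_homo (fun a b => b < a)%N) => [a b c /= ab bc|i j eqj].
  exact: ltn_trans bc ab.
have := no (i, j); rewrite /= eqj eqxx /= => /negbT.
rewrite -leqNgt leq_eqVlt => /orP[/eqP/val_inj/perm_inj eqij|//].
by move: eqj; rewrite eqij; lia.
Qed.

Lemma inversions1 : inversions 1 = set0.
Proof. by apply/setP => -[a b]; rewrite !inE !perm1 /=; lia. Qed.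

Lemma coxeter_lengthE w : coxeter_length w = #|inversions w|.
Proof.
rewrite /coxeter_length; case: ex_minnP => m w_in w_min; apply/eqP; rewrite eqn_leq.
apply/andP; split.
  (* Removing descents one at a time writes [w] as a product of as many simple reflections as it has
     inversions. *)
  apply: w_min; move: {2}#|_| (erefl #|inversions w|) => {w_in m} m.
  elim: m w => [|m IH] w cw.
    have [->|w1] := eqVneq w 1%g; first by rewrite inversions1 cards0 expg0 inE.
    have [i [j [eqj ltw]]] := has_descent w1.
    by have := card_inversions_descent eqj ltw; lia.
  have [w1|w1] := eqVneq w 1%g; first by rewrite w1 inversions1 cards0 in cw.
  have [i [j [eqj ltw]]] := has_descent w1.
  have cw' := card_inversions_descent eqj ltw.
  rewrite cw expgS; have -> : w = (tperm i j * (tperm i j * w))%g.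
    by rewrite mulgA tperm2 mul1g.
  have em : #|inversions (tperm i j * w)%g| = m by lia.
  apply: mem_mulg; last by rewrite -em IH.
  by apply/imsetP; exists (i, j); rewrite ?inE ?eqj.
(* Conversely, each simple reflection adds at most one inversion. *)
elim: m w w_in {w_min} => [|m IH] w.
  by rewrite expg0 inE => /eqP ->; rewrite inversions1 cards0.
rewrite expgS => /mulsgP[_ w' /imsetP[[i j] + ->] /IH le ->].
rewrite inE /= => /eqP eqj /=.
have [lt|lt|/val_inj/perm_inj eqij] := ltngtP (w' i) (w' j).
- by rewrite card_inversions_ascent.
- by apply: leqW; apply: leq_trans le; rewrite (card_inversions_descent eqj lt).
- by move: eqj; rewrite eqij; lia.
Qed.

Lemma coxeter_length_descent i j w : j = i.+1 :> nat -> (w j < w i)%N ->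
  coxeter_length w = (coxeter_length (tperm i j * w)%g).+1.
Proof. by move=> eqj ltw; rewrite !coxeter_lengthE; apply: card_inversions_descent. Qed.

(** Counts staircase cells in the shape of the product for the longest element, so that one factor
    beta goes to each cell. Reversing the second index turns pairs [a < b] into these cells. *)
Lemma coxeter_length_longest :
  coxeter_length (longest n) = \sum_(i < n) \sum_(j < n | (i.+1 + j.+1 <= n)%N) 1.
Proof.
rewrite coxeter_lengthE -sum1_card pair_big_dep /=.
rewrite (reindex (fun p : 'I_n * 'I_n => (p.1, rev_ord p.2))) /=; last first.
  by exists (fun p => (p.1, rev_ord p.2)) => -[a b] _ /=; rewrite rev_ordK.
apply: eq_bigl => -[a b]; rewrite !inE !permE /=.
by have := ltn_ord a; have := ltn_ord b; lia.
Qed.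

End Length.

(** * Grothendieck polynomials *)

(** A blank weighs [b * o c], and an upward elbow weighs [1 + b * o c], the two terms standing for
    unmarked and marked. *)
Lemma pipe_sum_marked (R : comNzRingType) n (b : R) (X Y : 'I_n -> R)
    (o : 'I_n * 'I_n -> R) (w : 'S_n) :
  (forall i j, X i * Y j = 1 + b * o (i, j)) ->
  pipe_sum X Y w = \sum_(PS in MPipes w)
    b ^+ (#|blanks PS.1| + #|PS.2|) * \prod_(c in blanks PS.1 :|: PS.2) o c.
Proof.
move=> XY; rewrite /pipe_sum.
transitivity (\sum_(P in Pipes w) \sum_(S : {set 'I_n * 'I_n} | S \subset upelbows P)
    b ^+ (#|blanks P| + #|S|) * \prod_(c in blanks P :|: S) o c); last first.
  by rewrite pair_big_dep; apply: eq_bigl => -[P S]; rewrite [RHS]in_set.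
apply: eq_bigr => P _; rewrite pair_big /=.
(* Expanding the product of F c + G c over cells amounts to choosing the marks. *)
pose F c := if c \in upelbows P then b * o c else 0.
pose G c := if c \in blanks P then b * o c else 1.
rewrite (eq_bigr (fun c => F c + G c)) => [|[i j] _]; last first.
  by rewrite /F /G !inE /= XY; case: (P i j) => /=; ring.
rewrite bigA_distr [RHS]big_mkcond; apply: eq_bigr => S _.
case: ifP => [/subsetP SU|/negbT/subsetPn [c cS cU]]; last first.
  by rewrite (bigD1 c) //= cS /F (negPf cU) mul0r.
(* Marks lie on upward elbows, hence off the blanks, so the exponent counts the cells of the
   union. *)
have dis : [disjoint blanks P & S].
  rewrite disjoint_sym; apply/pred0P => c /=; apply/negP => /andP[/SU].
  by rewrite !inE => /eqP ->.
have -> : (#|blanks P| + #|S| = #|blanks P :|: S|)%N.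
  by rewrite cardsU (disjoint_setI0 dis) cards0 subn0.
rewrite -prodr_const -big_split /= [RHS]big_mkcond; apply: eq_bigr => c _.
by rewrite inE orbC; case: ifP => [/SU cU|//]; rewrite /F cU.
Qed.

(** If [m i < k], the coefficient of degree [m i] vanishes on the left, while on the right it is [c]
    times a sum of nonnegative terms, one of them positive. *)
Lemma Xn_dvd_positive (I : finType) (A : {pred I}) (m d : I -> nat) k
    (H : {poly int}) (c : int) : c != 0 -> (forall i, i \in A -> 0 < d i)%N ->
  'X^k * H = c%:P * \sum_(i in A) 'X^(m i) * (d i)%:R%:P ->
  forall i, i \in A -> (k <= m i)%N.
Proof.
move=> c0 dpos eqH i iA; rewrite leqNgt; apply/negP => ltk.
move/(congr1 (fun p : {poly int} => p`_(m i))): eqH.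
rewrite coefXnM ltk coefCM coef_sum => /esym/eqP; rewrite mulf_eq0 (negPf c0) /=.
rewrite (eq_bigr (fun l => ((m i == m l) * d l)%N%:R)) => [|l _]; last first.
  by rewrite coefMC coefXn natrM.
rewrite -natr_sum (bigD1 i) //= eqxx mul1n.
by have := dpos i iA; rewrite Num.Theory.pnatr_eq0; lia.
Qed.

(* Instantiating mulfI at gring directly makes conversion unfold the nested ring
   structures; an abstract domain of coefficients avoids this. *)
Lemma mpoly_mulfI (A : idomainType) m (p q r : {mpoly A[m]}) :
  p != 0 -> p * q = p * r -> q = r.
Proof. by move=> p0; apply/mulfI. Qed.

Lemma mpoly2_mulfI (A : idomainType) m n (p q r : {mpoly {mpoly A[m]}[n]}) :
  p != 0 -> p * q = p * r -> q = r.
Proof. exact: mpoly_mulfI. Qed.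

(** With X = 1 + b x, the difference of the two X is [b * (xi - xj)], which absorbs one of the
    [k.+1] factors [b]. *)
Lemma factor_exchange (A : comNzRingType) (b xi xj z zs z' f sf : A) k :
  ((1 + b * xi) - (1 + b * xj)) * z' = (1 + b * xj) * z - (1 + b * xi) * zs ->
  z = b ^+ k.+1 * f -> zs = b ^+ k.+1 * sf ->
  b * ((xi - xj) * z') =
  b * (b ^+ k * ((1 + b * xj) * f - (1 + b * xi) * sf)).
Proof.
move=> E ez ezs; rewrite ez ezs exprS in E.
have -> : b * ((xi - xj) * z') = (1 + b * xi - (1 + b * xj)) * z' by ring.
rewrite E; ring.
Qed.

Section Main.

Variable n : nat.
Implicit Types (w : 'S_n) (i j : 'I_n).

(** The exponent is a truncated subtraction; [marked_exponent_ge] serves to show that nothing is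
    truncated. *)
Definition marked_sum w : gring n :=
  \sum_(PS in MPipes w)
    beta n ^+ (#|blanks PS.1| + #|PS.2| - coxeter_length w)
    * \prod_(c in blanks PS.1 :|: PS.2) oplus c.1 c.2.

Definition Xpar i : gring n := 1 + beta n * xvar i.
Definition Ypar j : gring n := 1 + beta n * yvar j.

Lemma XYpar i j : Xpar i * Ypar j = 1 + beta n * oplus i j.
Proof. rewrite /Xpar /Ypar /oplus; ring. Qed.

(* Evaluation at y = 0 and x_k = k + 1, which turns x_i (+) y_j into the positive
   integer i + 1. *)
Definition ev : gring n -> {poly int} :=
  mmap (meval (fun=> 0)) (fun i => i.+1%:R).

HB.instance Definition _ := GRing.RMorphism.on ev.

Lemma ev_beta : ev (beta n) = 'X.
Proof. by rewrite /ev /beta mmapC /= mevalC. Qed.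

Lemma ev_oplus i j : ev (oplus i j) = i.+1%:R.
Proof.
rewrite /oplus !rmorphD !rmorphM /= /ev /xvar /yvar mmapC !mmapX mmap1U /=.
by rewrite mevalXU !mulr0 !addr0.
Qed.

Lemma msym_beta s : msym s (beta n) = beta n.
Proof. exact: mmapC. Qed.

(** Permuting the x variables permutes the row parameters and fixes the column parameters and
    beta. *)
Lemma msym_pipe_sum s w :
  msym s (pipe_sum Xpar Ypar w) = pipe_sum (Xpar \o s) Ypar w.
Proof.
rewrite /pipe_sum rmorph_sum; apply: eq_bigr => P _.
rewrite rmorph_prod; apply: eq_bigr => i _.
rewrite rmorph_prod; apply: eq_bigr => j _.
have XY : msym s (Xpar i * Ypar j) = Xpar (s i) * Ypar j.
  have msym_x : msym s (xvar i) = xvar (s i) by rewrite /msym mmapX mmap1U.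
  have msym_y : msym s (yvar j) = yvar j := mmapC _ _ _.
  rewrite /Xpar /Ypar msymM !msymD !msymM !msym1 msym_beta msym_x msym_y.
  reflexivity.
by case: (P i j); rewrite /tile_weight /= ?msymB ?msym1 ?XY.
Qed.

Lemma pipe_sum_ev w : ev (pipe_sum Xpar Ypar w) = \sum_(PS in MPipes w)
  'X^(#|blanks PS.1| + #|PS.2|)
  * (\prod_(c in blanks PS.1 :|: PS.2) c.1.+1)%:R%:P.
Proof.
rewrite (pipe_sum_marked (b := beta n) (o := fun c => oplus c.1 c.2)); last first.
  exact: XYpar.
rewrite rmorph_sum; apply: eq_bigr => PS _.
rewrite rmorphM rmorphXn rmorph_prod /= ev_beta; congr (_ * _).
rewrite natr_prod rmorph_prod; apply: eq_bigr => c _.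
by rewrite ev_oplus /= rmorph_nat.
Qed.

(** Under [ev], divisibility by a power of beta becomes divisibility by a power of ['X], and every
    marked pipe dream gives a positive term. The factor [g] leaves room for [xvar i - xvar j]. *)
Lemma marked_exponent_ge w k (H g : gring n) (c : int) : c != 0 -> ev g = c%:P ->
  g * pipe_sum Xpar Ypar w = beta n ^+ k * H ->
  forall PS, PS \in MPipes w -> (k <= #|blanks PS.1| + #|PS.2|)%N.
Proof.
move=> c0 evg /(congr1 ev).
rewrite !rmorphM rmorphXn /= evg ev_beta pipe_sum_ev => /esym eqH.
apply: (Xn_dvd_positive c0 _ eqH) => PS _.
by rewrite prodn_gt0.
Qed.

Lemma pipe_sum_marked_sum w (H g : gring n) (c : int) : c != 0 -> ev g = c%:P ->
  g * pipe_sum Xpar Ypar w = beta n ^+ coxeter_length w * H ->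
  pipe_sum Xpar Ypar w = beta n ^+ coxeter_length w * marked_sum w.
Proof.
move=> c0 evg eqH; have le := marked_exponent_ge c0 evg eqH.
rewrite (pipe_sum_marked (b := beta n) (o := fun c => oplus c.1 c.2)); last first.
  exact: XYpar.
rewrite big_distrr; apply: eq_bigr => PS /le lePS.
by rewrite /= mulrA -exprD subnKC.
Qed.

Lemma ev_neq0 (g : gring n) : ev g != 0 -> g != 0.
Proof. by apply: contraNneq => ->; rewrite rmorph0. Qed.

Lemma gring_mulfI (p q r : gring n) : p != 0 -> p * q = p * r -> q = r.
Proof. exact: (@mpoly2_mulfI {poly int} n n p q r). Qed.

Lemma beta_mulfI k (f g : gring n) : beta n ^+ k * f = beta n ^+ k * g -> f = g.
Proof.
by apply: gring_mulfI; apply: ev_neq0; rewrite rmorphXn /= ev_beta monic_neq0 ?monicXn.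
Qed.

Lemma ev_xvarB i j : ev (xvar i - xvar j) = ((i : nat)%:R - (j : nat)%:R)%:P.
Proof.
rewrite rmorphB /= /ev /xvar !mmapX !mmap1U.
by rewrite rmorphB /= !rmorph_nat -!natr1; ring.
Qed.

Lemma xvarB_neq0 i j : i != j -> (i : nat)%:R - (j : nat)%:R != 0 :> int.
Proof.
move=> ij; rewrite subr_eq0 Num.Theory.eqr_nat.
by apply: contra ij => /eqP/val_inj ->.
Qed.

Lemma marked_sum_longest :
  pipe_sum Xpar Ypar (longest n)
    = beta n ^+ coxeter_length (longest n) * marked_sum (longest n) /\
  marked_sum (longest n) = \prod_(i < n) \prod_(j < n | (i.+1 + j.+1 <= n)%N) oplus i j.
Proof.
have eqZ : pipe_sum Xpar Ypar (longest n) = beta n ^+ coxeter_length (longest n) *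
    \prod_(i < n) \prod_(j < n | (i.+1 + j.+1 <= n)%N) oplus i j.
  rewrite pipe_sum_longest coxeter_length_longest.
  rewrite (big_morph _ (exprD (beta n)) (expr0 _)) -big_split; apply: eq_bigr => i _ /=.
  rewrite (big_morph _ (exprD (beta n)) (expr0 _)) -big_split; apply: eq_bigr => j _ /=.
  by rewrite XYpar expr1 addrC addKr.
have eqM : pipe_sum Xpar Ypar (longest n)
    = beta n ^+ coxeter_length (longest n) * marked_sum (longest n).
  (* No division is involved here, so the multiplier is 1. *)
  have ev1 : ev 1 = 1%:P by rewrite rmorph1 polyC1.
  apply: (pipe_sum_marked_sum (oner_neq0 int) ev1); rewrite mul1r; exact: eqZ.
split; first exact: eqM.
apply: (@beta_mulfI (coxeter_length (longest n))).
rewrite -eqM; exact: eqZ.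
Qed.

(** The exchange relation exhibits the power of beta dividing (x_i - x_j) Z(w s_i), which bounds the
    exponents; cancelling that power leaves the equation of pi_i. *)
Lemma marked_sum_descent w i j : j = i.+1 :> nat -> (w j < w i)%N ->
  pipe_sum Xpar Ypar w = beta n ^+ coxeter_length w * marked_sum w ->
  pipe_sum Xpar Ypar (tperm i j * w)%g
    = beta n ^+ coxeter_length (tperm i j * w)%g * marked_sum (tperm i j * w)%g /\
  is_pi i j (marked_sum w) (marked_sum (tperm i j * w)%g).
Proof.
move=> eqj ltw eqM; set l := coxeter_length (tperm i j * w)%g.
have ij : i != j by apply/eqP => e; move: eqj; rewrite e; lia.
have eqX : (xvar i - xvar j) * pipe_sum Xpar Ypar (tperm i j * w)%g =
    beta n ^+ l * (Xpar j * marked_sum w - Xpar i * msym (tperm i j) (marked_sum w)).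
  have E := pipe_sum_exchange Xpar Ypar eqj ltw.
  have eqM1 : pipe_sum Xpar Ypar w = beta n ^+ l.+1 * marked_sum w.
    by rewrite -(coxeter_length_descent eqj ltw).
  have Es : pipe_sum (Xpar \o tperm i j) Ypar w
      = beta n ^+ l.+1 * msym (tperm i j) (marked_sum w).
    rewrite -(msym_pipe_sum (tperm i j)) eqM1 msymM rmorphXn /= msym_beta.
    reflexivity.
  apply: (@gring_mulfI (beta n)); first by apply: ev_neq0; rewrite ev_beta polyX_eq0.
  exact: (factor_exchange E eqM1 Es).
have eqM' : pipe_sum Xpar Ypar (tperm i j * w)%g
    = beta n ^+ l * marked_sum (tperm i j * w)%g.
  exact: pipe_sum_marked_sum (xvarB_neq0 ij) (ev_xvarB i j) eqX.
split; first exact: eqM'.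
apply: (@beta_mulfI l).
by have := eqX; rewrite eqM' mulrCA; apply.
Qed.

(** Downward induction from the longest element, measured by the number of missing inversions. The
    factorisation of Z(w) is carried along because the descent step needs it. *)
Lemma grothendieck_marked_sum w :
  pipe_sum Xpar Ypar w = beta n ^+ coxeter_length w * marked_sum w /\
  is_grothendieck w (marked_sum w).
Proof.
have [m] := ubnP (#|{: 'I_n * 'I_n}| - #|inversions w|)%N.
elim: m w => [//|m IH] w lem.
have [->|w0] := eqVneq w (longest n).
  have [eqZ eqM] := marked_sum_longest; split; first exact: eqZ.
  by rewrite eqM; apply: Groth_longest.
have [i [j [eqj ltw]]] := has_ascent w0.
pose w' := (tperm i j * w)%g.
have ltw' : (w' j < w' i)%N by rewrite /w' !permM tpermL tpermR.
have wE : w = (tperm i j * w')%g by rewrite mulgA tperm2 mul1g.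
have [|eqZ grw] := IH w'.
  have maxw : (#|inversions w'| <= #|{: 'I_n * 'I_n}|)%N := max_card _.
  have cw' : #|inversions w'| = #|inversions w|.+1 := card_inversions_ascent eqj ltw.
  by move: maxw lem; rewrite cw'; lia.
have [eqZ' pi] := marked_sum_descent eqj ltw' eqZ.
by rewrite wE; split; [exact: eqZ' | exact: Groth_descent eqj ltw' grw pi].
Qed.

(** The ring is a domain, and [ev] sends [xvar i - xvar j] to a nonzero integer. *)
Lemma is_pi_inj i j (f g h : gring n) : j = i.+1 :> nat ->
  is_pi i j f g -> is_pi i j f h -> g = h.
Proof.
move=> eqj pig pih; apply: (@gring_mulfI (xvar i - xvar j)); last by rewrite pig pih.
apply: ev_neq0; rewrite ev_xvarB polyC_eq0 xvarB_neq0 //.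
by apply/eqP => e; move: eqj; rewrite e; lia.
Qed.

(** Each step of a derivation has a single possible value, already attained by [marked_sum]; the
    chosen chain of descents is therefore irrelevant. *)
Lemma grothendieck_unique w g : is_grothendieck w g -> g = marked_sum w.
Proof.
elim=> [|{}w i j f {}g eqj ltw _ -> pi]; first by case: marked_sum_longest.
have [eqZ _] := grothendieck_marked_sum w.
by have [_] := marked_sum_descent eqj ltw eqZ; apply: is_pi_inj pi.
Qed.

End Main.

Theorem corollary1p5 (n : nat) (hn : (1 <= n)%N) (w : 'S_n) (g : gring n) :
  is_grothendieck w g <->
  g = \sum_(PS in MPipes w)
        beta n ^+ (#|blanks PS.1| + #|PS.2| - coxeter_length w)
        * \prod_(c in blanks PS.1 :|: PS.2) oplus c.1 c.2.
Proof.
split=> [/grothendieck_unique // | ->].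
by case: (grothendieck_marked_sum w).
Qed.
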